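(* Let $m\in\mathbb{N}\setminus\{0\}$ and $p\in(\mathbb{N}\setminus\{0\})\cup\{\infty\}$. Let $f\colon\mathbb{R}^m\to\mathbb{R}$ be continuous and piecewise-$C^p$, and let $(\{P^j\}_{j=1}^J,\{f^j\}_{j=1}^J)$ be a representation of $f$. Let $$D_f(x)\coloneqq\{\nabla f^j(x): j\in\{1,\ldots,J\},\ x\in\operatorname{cl}P^j\},\qquad x\in\mathbb{R}^m.$$ Then the convex-valued conservative field $\operatorname{conv}D_f\colon x\mapsto\operatorname{conv}D_f(x)$ for $f$ is a semismooth generalized gradient of $f$.
   Context: A continuous function $f\colon\mathbb{R}^m\to\mathbb{R}$ is piecewise-$C^p$ if there exist a finite Borel partition $\mathbb{R}^m=\bigsqcup_{j=1}^J P^j$ (nonempty, pairwise disjoint Borel sets) and $C^p$ functions $f^1,\ldots,f^J\colon\mathbb{R}^m\to\mathbb{R}$ such that $f(x)=f^j(x)$ whenever $x\in P^j$. The pair $(\{P^j\}_{j=1}^J,\{f^j\}_{j=1}^J)$ is called a representation of $f$. Every such function is locally Lipschitz. A set-valued map $D\colon\mathbb{R}^m\rightrightarrows\mathbb{R}^m$ is locally bounded if every point $x$ has a neighborhood $\mathcal N$ such that $\bigcup_{z\in\mathcal N}D(z)$ is bounded; it is graph-closed if $\{(x,y): y\in D(x)\}$ is closed. A conservative field for a locally Lipschitz function $\varphi\colon\mathbb{R}^m\to\mathbb{R}$ is a locally bounded, graph-closed set-valued map $D\colon\mathbb{R}^m\rightrightarrows\mathbb{R}^m$ with nonempty values such that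 for every Lipschitz curve $v\colon[0,1]\to\mathbb{R}^m$, for almost all $t\in[0,1]$, $\frac{d}{dt}\varphi(v(t))=\langle\dot v(t),u\rangle$ for all $u\in D(v(t))$. A locally bounded, graph-closed set-valued map $D\colon\mathbb{R}^m\rightrightarrows\mathbb{R}^m$ with nonempty, compact, convex values is a semismooth (Norkin) generalized gradient of a locally Lipschitz function $\varphi\colon\mathbb{R}^m\to\mathbb{R}$ if, for every $x\in\mathbb{R}^m$, $$\sup_{\xi\in D(x+h)}|\varphi(x+h)-\varphi(x)-\langle\xi,h\rangle|=o(\|h\|)\quad\text{as }h\to0.$$ *)

(* Defs.v *)
From HB Require Import structures.
From mathcomp Require Import all_boot all_order all_algebra.
From mathcomp Require Import all_classical all_reals all_analysis.

Set Implicit Arguments.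
Unset Strict Implicit.
Unset Printing Implicit Defensive.

Import Order.TTheory GRing.Theory Num.Theory.
Import numFieldNormedType.Exports.

Local Open Scope classical_set_scope.
Local Open Scope ring_scope.

(* The space R^m is 'rV[R]_m; the library norm `|x| on it is the max norm. The
   norm only enters below through local boundedness, Lipschitz continuity and
   o(`|h|), none of which changes under an equivalent norm. *)

Section Defs.
Context {R : realType} {m : nat}.
Implicit Types (f phi : 'rV[R]_m -> R) (D : 'rV[R]_m -> set 'rV[R]_m).

Definition dotv (x y : 'rV[R]_m) : R := \sum_i x 0 i * y 0 i.

Definition pderiv (i : 'I_m) f : 'rV[R]_m -> R :=
  fun x => 'D_(delta_mx 0 i) f x.

Definition grad f (x : 'rV[R]_m) : 'rV[R]_m := \row_i pderiv i f x.

(* f is C^(k+1) iff it is Frechet differentiable everywhere and the coordinates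
   of its derivative, i.e. its partial derivatives, are C^k. *)
Fixpoint is_Ck (k : nat) f : Prop :=
  if k is k'.+1 then
    (forall x, differentiable f x) /\ (forall i, is_Ck k' (pderiv i f))
  else continuous f.

(* None stands for the order infinity. *)
Definition is_Cp (p : option nat) f : Prop :=
  if p is Some k then is_Ck k f else forall k, is_Ck k f.

Definition borel : set (set 'rV[R]_m) := <<s [set A | open A] >>.

Record representation (p : option nat) f (J : nat)
    (P : 'I_J -> set 'rV[R]_m) (fs : 'I_J -> 'rV[R]_m -> R) : Prop := {
  repr_borel : forall j, borel (P j) ;
  repr_nonempty : forall j, P j !=set0 ;
  repr_disjoint : forall i j, i != j -> P i `&` P j = set0 ;
  repr_cover : \bigcup_(j in [set: 'I_J]) P j = [set: 'rV[R]_m] ;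
  repr_smooth : forall j, is_Cp p (fs j) ;
  repr_agree : forall j x, P j x -> f x = fs j x }.

Definition piecewise_Cp (p : option nat) f : Prop :=
  continuous f /\ exists J (P : 'I_J -> set 'rV[R]_m) fs, representation p f P fs.

Definition locally_lipschitz phi : Prop :=
  forall x : 'rV[R]_m,
    exists2 N : set 'rV[R]_m, nbhs x N & [lipschitz phi z | z in N].

Definition locally_bounded D : Prop :=
  forall x : 'rV[R]_m,
    exists2 N : set 'rV[R]_m, nbhs x N & bounded_set (\bigcup_(z in N) D z).

Definition graph_closed D : Prop :=
  closed [set xy : 'rV[R]_m * 'rV[R]_m | D xy.1 xy.2].

(* Only the restriction of v to [0, 1] matters: the values 'D_1 v t at the
   endpoints, which see the extension of v, lie in a null set. Existence of
   both derivatives is part of the chain rule. *)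
Definition chain_rule_along phi D (v : R -> 'rV[R]_m) : Prop :=
  {ae (@lebesgue_measure R), forall t : R, `[0, 1]%classic t ->
     [/\ derivable v t 1,
         derivable (phi \o v) t 1 &
         forall u, D (v t) u -> 'D_1 (phi \o v) t = dotv ('D_1 v t) u]}.

Record conservative_field phi D : Prop := {
  cf_lip : locally_lipschitz phi ;
  cf_bounded : locally_bounded D ;
  cf_closed : graph_closed D ;
  cf_nonempty : forall x, D x !=set0 ;
  cf_chain : forall v : R -> 'rV[R]_m,
    [lipschitz v t | t in `[0, 1]%classic] -> chain_rule_along phi D v }.

(* The supremum is finite, as D (x + h) is nonempty and compact. *)
Record semismooth_gradient phi D : Prop := {
  sg_lip : locally_lipschitz phi ;
  sg_bounded : locally_bounded D ;
  sg_closed : graph_closed D ;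
  sg_nonempty : forall x, D x !=set0 ;
  sg_compact : forall x, compact (D x) ;
  sg_convex : forall x, convex_set (D x : set (convex_lmodType _)) ;
  sg_semismooth : forall x : 'rV[R]_m,
    (fun h : 'rV[R]_m =>
       sup [set `|phi (x + h) - phi x - dotv xi h| | xi in D (x + h)])
    =o_ (0 : 'rV[R]_m) id }.

Definition conv_hull (A : set 'rV[R]_m) : set 'rV[R]_m :=
  [set y | exists n (a : 'I_n -> R) (z : 'I_n -> 'rV[R]_m),
     [/\ forall i, 0 <= a i, \sum_i a i = 1, forall i, A (z i) &
         y = \sum_i a i *: z i]].

Definition active_grads (J : nat) (P : 'I_J -> set 'rV[R]_m)
    (fs : 'I_J -> 'rV[R]_m -> R) (x : 'rV[R]_m) : set 'rV[R]_m :=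
  [set grad (fs j) x | j in [set j | closure (P j) x]].

End Defs.

(* Main.v *)
(** By continuity [f] agrees with [fs j] on the closure of [P j], and for [y] near
    [x] every piece active at [y] is active at [x].  Hence increments of [f] at
    [x] are increments of active [fs j], so semismoothness and the local Lipschitz
    bound reduce to first-order expansions of the [fs j].  For the chain rule
    along a Lipschitz curve [v], which is differentiable almost everywhere: where
    [i] and [j] are both active, [(fs i - fs j) \o v] vanishes, and a zero with
    nonzero derivative is isolated, so off a countable set all active gradients
    give the same directional derivative along [v]. *)

Require Import Defs.
From HB Require Import structures.
From mathcomp Require Import all_boot all_order all_algebra.
From mathcomp Require Import all_classical all_reals all_analysis.
From mathcomp Require Import lra.
Import Order.TTheory GRing.Theory Num.Theory.
Import numFieldNormedType.Exports.
Local Open Scope classical_set_scope.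
Local Open Scope ring_scope.

Set Implicit Arguments.
Unset Strict Implicit.
Unset Printing Implicit Defensive.

(** * Lipschitz functions of one real variable *)

Lemma nonexpansive_continuous (R : realType) (w : R -> R) :
  (forall x y, `|w x - w y| <= `|x - y|) -> continuous w.
Proof.
move=> w1 x; apply/cvgrPdist_lt => /= e e0; near=> y.
by rewrite (le_lt_trans (w1 _ _))//; near: y; exact: cvgr_dist_lt.
Unshelve. all: by end_near. Qed.

(** A nonexpansive [w] cannot fall faster than [x] rises, so [x + w x] is nondecreasing; continuity
    of [w] supplies the right continuity required of a Stieltjes integrator. *)
Lemma cumulative_half_add_id (R : realType) (w : R -> R) :
  (forall x y, `|w x - w y| <= `|x - y|) ->
  exists G : cumulative R R, G =1 (fun x => 2^-1 * (x + w x)).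
Proof.
move=> w1; pose g x : R := 2^-1 * (x + w x).
have nd : nondecreasing g.
  move=> x y xy; rewrite /g ler_pM2l ?invr_gt0//.
  have := w1 x y; rewrite [X in _ <= X]ler0_norm ?subr_le0// ler_norml.
  by move=> /andP[? ?]; lra.
have rc : right_continuous g.
  apply: right_continuousW => x.
  apply: cvgM; first exact: cvg_cst.
  by apply: cvgD => //; exact: nonexpansive_continuous.
pose mixin := isCumulative.Build R _ R g nd rc.
by exists (HB.pack_for (cumulative R R) g mixin).
Qed.

Lemma lebesgue_stieltjes_measure_oc (R : realType) (G : cumulative R R)
    (a b : R) : a <= b ->
  lebesgue_stieltjes_measure G `]a, b]%classic = (G b - G a)%:E.
Proof.
move=> ab; rewrite /lebesgue_stieltjes_measure /measure_extension.
by rewrite measurable_mu_extE/= ?wlength_itv_bnd//; exact: is_ocitv.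
Qed.

(** The Stieltjes measures of [G] and [H] together give each []a, b]] its length, so by uniqueness
    their sum is Lebesgue measure; the nonnegative contribution of [H] is then dropped. *)
Lemma lebesgue_stieltjes_measure_le (R : realType) (G H : cumulative R R)
    (A : set R) : (forall x, G x + H x = x) -> measurable A ->
  (lebesgue_stieltjes_measure G A <= @lebesgue_measure R A)%E.
Proof.
move=> GH mA.
pose nu : {measure set (measurableTypeR R) -> \bar R} := measure_add
   (lebesgue_stieltjes_measure G) (lebesgue_stieltjes_measure H).
have nuE B : nu B = (lebesgue_stieltjes_measure G B +
    lebesgue_stieltjes_measure H B)%E by exact: measure_addE.
suff -> : @lebesgue_measure R A = nu A by rewrite nuE leeDl.
apply: lebesgue_measure_unique mA => _ /ocitvP[->|[[a b] /= ab ->]].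
  by rewrite !measure0.
rewrite nuE /lebesgue_measure !lebesgue_stieltjes_measure_oc ?ltW//=.
by rewrite -EFinD; congr EFin; rewrite -{1}(GH a) -{1}(GH b); lra.
Qed.

(* Both [(x + w x) / 2] and [(x - w x) / 2] are nondecreasing and sum to [x], so
   the Stieltjes measure of the former is dominated by Lebesgue measure; its
   Radon-Nikodym density turns [w] into an indefinite integral. *)
Lemma nonexpansive_ae_derivable (R : realType) (w : R -> R) (a b : R) :
  (forall x y, `|w x - w y| <= `|x - y|) ->
  {ae (@lebesgue_measure R), forall t, a < t < b -> derivable w t 1}.
Proof.
move=> w1.
have [ab|ba] := ltP a b; last first.
  apply/aeW => t /andP[at_ tb].
  by move: (lt_trans at_ tb); rewrite ltNge ba.
have [G GE] := cumulative_half_add_id w1.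
have [H HE] : exists G : cumulative R R, G =1 (fun x => 2^-1 * (x + - w x)).
  apply: (@cumulative_half_add_id R (fun x => - w x)) => x y.
  by rewrite -opprD normrN.
have GH x : G x + H x = x by rewrite GE HE; lra.
pose D : set (measurableTypeR R) := `]a, b]%classic.
have mD : measurable D by exact: measurable_itv.
(* Restricting to []a, b]] makes the measure finite, as the Radon-Nikodym step needs. *)
have nuD : (lebesgue_stieltjes_measure G D < +oo)%E.
  by rewrite lebesgue_stieltjes_measure_oc ?ltW// ltry.
pose nu : {finite_measure set (measurableTypeR R) -> \bar R} := mfrestr mD nuD.
have nu_mu : nu `<< @lebesgue_measure R.
  apply/null_content_dominatesP => A mA mA0.
  apply/eqP; rewrite eq_le measure_ge0 andbT -mA0 /nu /= /mfrestr /mrestr.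
  apply: (le_trans (lebesgue_stieltjes_measure_le GH _)).
    exact: measurableI.
  by apply: le_measure; rewrite ?inE//; exact: measurableI.
have [phi [phi0 phifin iphi nuE]] := radon_nikodym_sigma_finite nu_mu.
pose F x : R := (\int[@lebesgue_measure R]_(t in `]a, x]) fine (phi t))%R.
have phiE : EFin \o (fine \o phi) = phi.
  by apply/funext => x /=; rewrite fineK.
have FE x : a <= x <= b -> F x = G x - G a.
  move=> /andP[ax xb]; rewrite /F /Rintegral.
  under eq_integral do rewrite fineK//.
  rewrite -nuE//= /mfrestr /mrestr setIidl.
    by rewrite lebesgue_stieltjes_measure_oc.
  by apply: subset_itvl; rewrite bnd_simp.
have := @FTC1 R (fine \o phi) (BRight a).
have iphi' : lebesgue_measure.-integrable setT (EFin \o (fine \o phi)).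
  by rewrite phiE.
move=> /(_ _)/(_ _).
case => [y||].
- by apply: integrableS iphi' => //; exact: measurable_itv.
- by apply: open_integrable_locally => //; exact: openT.
move=> N [mN N0 NP]; exists N; split => // t /=.
move=> nt; apply: NP => /= Ft; apply: nt => /andP[at_ tb].
have {Ft}[|dF _] := Ft; first by rewrite lte_fin.
(* Solving [G x = (x + w x) / 2] for [w], with [G = F + G a] on [[a, b]], shows that this function
   is [w] near [t]. *)
have dw : derivable (fun x => 2 * (F x + G a) - x) t 1.
  apply: derivableB => //; apply: derivableM => //.
  exact: derivableD.
apply: near_eq_derivable dw; near=> x => /=.
rewrite FE.
  by rewrite subrK GE; lra.
apply/andP; split; apply/ltW; near: x.
  exact: lt_nbhsr.
exact: lt_nbhsl.
Unshelve. all: by end_near. Qed.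

(** Clamping the argument to [[a, b]] and dividing by a positive Lipschitz constant [k] gives a
    nonexpansive function on the whole line that equals [v / k] near every interior point. *)
Lemma lipschitz_ae_derivable (R : realType) (v : R -> R) (a b : R) :
  [lipschitz v t | t in `[a, b]%classic] ->
  {ae (@lebesgue_measure R), forall t, a < t < b -> derivable v t 1}.
Proof.
have [ab|ba] := ltP a b; last first.
  move=> _; apply/aeW => t /andP[at_ tb].
  by move: (lt_trans at_ tb); rewrite ltNge ba.
move=> /pinfty_ex_gt0[k k0 vk].
pose cl x : R := Num.max a (Num.min x b).
have clab x : cl x \in `[a, b].
  by rewrite in_itv /= /cl le_max lexx /= ge_max ge_min lexx orbT ltW.
have cl1 x y : `|cl x - cl y| <= `|x - y|.
  have n1 := ler_norm (x - y); have n2 := ler_norm (- (x - y)).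
  rewrite normrN in n2.
  by rewrite /cl; case: (leP x b) => xb; case: (leP y b) => yb;
    rewrite ?(max_r (ltW ab)); case: (leP a x) => ax; case: (leP a y) => ay;
    rewrite ler_norml; apply/andP; split; lra.
have := @nonexpansive_ae_derivable R (fun x => k^-1 * v (cl x)) a b.
move=> /(_ _)[x y|N [mN N0 NP]].
  rewrite -mulrBr normrM gtr0_norm ?invr_gt0// ler_pdivrMl//.
  have /vk/= vkxy : (`[a, b] `*` `[a, b])%classic (cl x, cl y).
    by split; exact: clab.
  by apply: (le_trans vkxy); rewrite ler_pM2l.
exists N; split => // t /= nt; apply: NP => /= Ft; apply: nt => atb.
have dv : derivable (fun x => k * (k^-1 * v (cl x))) t 1.
  by apply: derivableM => //; exact: Ft.
apply: near_eq_derivable dv; near=> x.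
rewrite mulVKf ?gt_eqF//; congr v.
rewrite /cl (min_idPl _) ?(max_idPr _)//; apply/ltW; near: x.
  by apply: lt_nbhsr; case/andP: atb.
by apply: lt_nbhsl; case/andP: atb.
Unshelve. all: by end_near. Qed.

(** * First-order expansions *)

Section DotProduct.
Context {R : realType} {m : nat}.
Implicit Types x y z : 'rV[R]_m.

Lemma dotvC x y : dotv x y = dotv y x.
Proof. by apply: eq_bigr => i _; rewrite mulrC. Qed.

Lemma dotvBl x y z : dotv (x - y) z = dotv x z - dotv y z.
Proof.
by rewrite /dotv -sumrB; apply: eq_bigr => i _; rewrite !mxE mulrBl.
Qed.

Lemma dotvZl (a : R) x y : dotv (a *: x) y = a * dotv x y.
Proof.
by rewrite /dotv mulr_sumr; apply: eq_bigr => i _; rewrite !mxE mulrA.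
Qed.

Lemma dotv_suml n (z : 'I_n -> 'rV[R]_m) y :
  dotv (\sum_i z i) y = \sum_i dotv (z i) y.
Proof.
rewrite /dotv exchange_big /=; apply: eq_bigr => i _.
by rewrite summxE mulr_suml.
Qed.

Lemma coord_norm_le x i : `|x 0 i| <= `|x|.
Proof.
by rewrite [leRHS]/Num.Def.normr/= mx_normrE (le_bigmax _ _ (ord0, i)).
Qed.

Lemma dotv_norm_le x y : `|dotv x y| <= m%:R * `|x| * `|y|.
Proof.
rewrite (le_trans (ler_norm_sum _ _ _))//.
apply: (@le_trans _ _ (\sum_(i < m) `|x| * `|y|)).
  by apply: ler_sum => i _; rewrite normrM ler_pM// coord_norm_le.
by rewrite sumr_const card_ord -mulrA mulr_natl.
Qed.

Lemma diff_grad (f : 'rV[R]_m -> R) x h :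
  differentiable f x -> 'd f x h = dotv (grad f x) h.
Proof.
move=> df; rewrite {1}(row_sum_delta h) linear_sum; apply: eq_bigr => i _.
by rewrite linearZ /= -deriveE// mxE mulrC.
Qed.

End DotProduct.

Section FirstOrder.
Context {R : realType} {m : nat}.
Implicit Types (f : 'rV[R]_m -> R) (x y : 'rV[R]_m).

Lemma is_Ck_continuous k f : is_Ck k f -> continuous f.
Proof.
by case: k => [//|k] [df _] x; exact: differentiable_continuous.
Qed.

Lemma is_Cp_C1 p f : p <> Some 0%N -> is_Cp p f ->
  (forall x, differentiable f x) /\ continuous (grad f).
Proof.
move=> p0 Cf.
have [k [df Ckf]] : exists k, is_Ck k.+1 f.
  by case: p p0 Cf => [[//|k]|] _ Cf; [exists k|exists 0%N; exact: Cf].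
split => // x.
have cj j : {for x, continuous (pderiv j f)}.
  by apply: is_Ck_continuous (Ckf j) x.
apply/(@cvgrPdist_le _ _ _ (nbhs x) (nbhs_filter x)) => e e0.
have : \forall y \near x, forall j, `|pderiv j f x - pderiv j f y| <= e.
  by apply: (filter_forall (nbhs_filter x)) => j; have /cvgrPdist_le := cj j; exact.
apply: filterS => y xy.
rewrite [leLHS]/Num.Def.normr/= mx_normrE (bigmax_le _ (ltW e0))//= => -[i j] _.
by rewrite !mxE.
Qed.

Lemma near_first_order f x (e : R) : differentiable f x -> 0 < e ->
  \forall y \near x,
    `|f y - f x - dotv (grad f x) (y - x)| <= e * `|y - x|.
Proof.
move=> df e0; have /eqaddoP/(_ _ e0) H := diff_locally df.
apply/nbhs0P; apply: filterS H => h /=.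
by rewrite [x + h]addrC addrK -diff_grad// opprD addrA.
Qed.

(** Semismoothness evaluates the gradient at the moving point [y]. Replacing [grad f x] by
    [grad f y] costs [dotv (grad f x - grad f y) (y - x)], which continuity of the gradient makes
    small. *)
Lemma near_first_order_end f x (e : R) :
  differentiable f x -> {for x, continuous (grad f)} -> 0 < e ->
  \forall y \near x,
    `|f y - f x - dotv (grad f y) (y - x)| <= e * `|y - x|.
Proof.
move=> df cf e0.
(* The factor [m] comes from bounding [dotv] by max norms; adding 1 makes it a positive divisor. *)
have m0 : 0 < m%:R + 1 :> R by rewrite ltr_wpDl.
have em0 : 0 < e / 2 / (m%:R + 1) by rewrite !divr_gt0.
have /cvgrPdist_le/(_ _ em0) Hg := cf.
have /(near_first_order df) Hf : 0 < e / 2 by rewrite divr_gt0.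
apply: filterS2 Hf Hg => y Hf Hg.
rewrite -(subrKA (dotv (grad f x) (y - x))) (le_trans (ler_normD _ _))//.
rewrite [e in leRHS](splitr e) mulrDl lerD// -dotvBl.
rewrite (le_trans (dotv_norm_le _ _))// ler_wpM2r//.
apply: (@le_trans _ _ ((m%:R + 1) * (e / 2 / (m%:R + 1)))).
  by rewrite ler_pM// lerDl.
by rewrite mulrC divfK// gt_eqF.
Qed.

Lemma near_slope_le f x (M : R) : differentiable f x -> `|grad f x| <= M ->
  \forall y \near x, `|f y - f x| <= (m%:R * M + 1) * `|y - x|.
Proof.
(* Tolerance 1 in the expansion yields the summand 1 of the slope; [m%:R * M] bounds the linear
   term. *)
move=> df fM; have := near_first_order df ltr01.
apply: filterS => y; rewrite mul1r => H.
rewrite -[f y - f x](subrK (dotv (grad f x) (y - x))).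
rewrite (le_trans (ler_normD _ _))// mulrDl mul1r addrC lerD//.
by rewrite (le_trans (dotv_norm_le _ _))// ler_wpM2r// ler_wpM2l.
Qed.

End FirstOrder.

(* The set of [t] in [[0, 1]] with [`|g t - g 0| <= K * t] contains its
   supremum, and the local bound pushes it further right unless it is [1]. *)
Lemma le_slope_segment (R : realType) (g : R -> R) (K : R) :
  (forall t : R, 0 <= t <= 1 -> \forall s \near t, `|g s - g t| <= K * `|s - t|) ->
  `|g 1 - g 0| <= K.
Proof.
move=> gK; pose S := [set t : R | 0 <= t <= 1 /\ `|g t - g 0| <= K * t].
have S0 : S 0 by split; rewrite ?lexx ?ler01// subrr normr0 mulr0.
have Sub : has_ubound S by exists 1 => t [/andP[]].
set c := sup S.
have c0 : 0 <= c by exact: ub_le_sup.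
have c1 : c <= 1 by apply: ge_sup; [exists 0|move=> t [/andP[]]].
have c01 : 0 <= c <= 1 by rewrite c0.
have /nbhs_ballP[d /= d0 gd] := gK _ c01.
(* Some member of [S] lies within [d] below [c], and the local bound at [c] carries its estimate
   over to [c]. *)
have Sc : S c.
  split => //.
  have [s Ss cs] : exists2 s, S s & c - d < s.
    by apply: sup_adherent => //; split => //; exists 0.
  have sc : s <= c by exact: ub_le_sup.
  have [_ gs] := Ss.
  have /gd : ball c d s.
    by rewrite /ball/= ger0_norm ?subr_ge0// ltrBlDr addrC -ltrBlDr.
  rewrite /= distrC (distrC s c) (ger0_norm (x := c - s)) ?subr_ge0// => gsc.
  rewrite -(subrKA (g s)) (le_trans (ler_normD _ _))//.
  by rewrite (le_trans (lerD gsc gs))// -mulrDr subrK.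
have [cE|cN1] := eqVneq c 1; first by case: Sc => _; rewrite cE mulr1.
have {cN1}c1' : c < 1 by rewrite lt_neqAle cN1.
have [s [cs s1 sd]] : exists s, [/\ c < s, s <= 1 & s - c < d].
  have [h|h] := leP (c + d / 2) 1.
    by exists (c + d / 2); split => //; lra.
  by exists 1; split => //; lra.
suff : s <= c by rewrite leNgt cs.
apply: ub_le_sup => //; split; first by rewrite s1 andbT (le_trans c0)// ltW.
have /gd : ball c d s.
  by rewrite /ball/= distrC gtr0_norm ?subr_gt0.
rewrite /= (gtr0_norm (x := s - c)) ?subr_gt0// => gsc.
rewrite -(subrKA (g c)) (le_trans (ler_normD _ _))//.
by rewrite (le_trans (lerD gsc Sc.2))// -mulrDr subrK.
Qed.

(** Balls are convex, so the segment between the two points stays where the local slope bound holds,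
    and [le_slope_segment] applies to [f] along it. *)
Lemma lipschitz_ball_of_near (R : realType) (V : normedModType R)
    (f : V -> R) (a : V) (r L : R) :
  (forall x, ball a r x -> \forall y \near x, `|f y - f x| <= L * `|y - x|) ->
  forall x y, ball a r x -> ball a r y -> `|f x - f y| <= L * `|x - y|.
Proof.
move=> fL y x ay ax.
pose l t := x + t *: (y - x).
have := @le_slope_segment R (f \o l) (L * `|y - x|).
rewrite /= /l scale1r scale0r addr0 (addrC x (y - x)) subrK.
apply => t /andP[t0 t1].
have alt : ball a r (l t).
  move: ax ay; rewrite -!ball_normE /= => ax ay.
  have -> : a - l t = (1 - t) *: (a - x) + t *: (a - y).
    rewrite scalerBl scale1r -addrA -scalerN -scalerDr /l opprD addrA -scalerN.
    by rewrite !opprB subrKA.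
  pose M := Num.max `|a - x| `|a - y|.
  have Mr : M < r by rewrite gt_max ax ay.
  apply: le_lt_trans Mr; rewrite (le_trans (ler_normD _ _))// !normrZ.
  rewrite ger0_norm ?subr_ge0// (ger0_norm t0).
  apply: (@le_trans _ _ ((1 - t) * M + t * M)); last first.
    by rewrite -mulrDl subrK mul1r.
  by rewrite lerD// ler_wpM2l ?subr_ge0// /M le_max lexx ?orbT.
have lc : l s @[s --> t] --> l t.
  apply: (@cvgD _ V _ (nbhs t) _ (cst x) (fun s => s *: (y - x))).
    exact: cvg_cst.
  by apply: (@cvgZr_tmp _ V _ (nbhs t) _ id t (y - x)); exact: cvg_id.
have H : \forall s \near t, `|f (l s) - f (l t)| <= L * `|l s - l t| :=
  lc _ (fL _ alt).
apply: filterS H => s /= H; apply: (le_trans H).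
rewrite /l opprD addrACA subrr add0r -scalerBl normrZ.
by rewrite mulrCA mulrC.
Qed.

(** * Convex hulls of active gradients *)

Lemma sum_continuous (R : realType) (T : topologicalType) (V : normedModType R)
    n (F : 'I_n -> T -> V) :
  (forall i, continuous (F i)) -> continuous (fun x => \sum_i F i x).
Proof.
move=> cF; apply: continuous_big; last by move=> i _; exact: cF.
exact: add_continuous.
Qed.

Section Hull.
Context {R : realType} {m : nat}.

(** The bound is asked only where the weight is nonzero, because in a hull of active gradients only
    those indices are known to be active. *)
Lemma wavg_norm_le n (a : 'I_n -> R) (z : 'I_n -> 'rV[R]_m) (M : R) :
  (forall i, 0 <= a i) -> \sum_i a i = 1 ->
  (forall i, a i != 0 -> `|z i| <= M) -> `|\sum_i a i *: z i| <= M.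
Proof.
move=> a0 a1 zM; rewrite (le_trans (ler_norm_sum _ _ _))//.
apply: (@le_trans _ _ (\sum_i a i * M)); last by rewrite -mulr_suml a1 mul1r.
apply: ler_sum => i _; rewrite normrZ ger0_norm//.
by have [->|ai] := eqVneq (a i) 0; rewrite ?mul0r// ler_wpM2l// zM.
Qed.

Lemma wavg_dist_le n (a c : 'I_n -> R) (b M : R) :
  (forall i, 0 <= a i) -> \sum_i a i = 1 ->
  (forall i, a i != 0 -> `|b - c i| <= M) -> `|b - \sum_i a i * c i| <= M.
Proof.
move=> a0 a1 zM; rewrite -[b]mul1r -a1 mulr_suml -sumrB.
rewrite (le_trans (ler_norm_sum _ _ _))//.
apply: (@le_trans _ _ (\sum_i a i * M)); last by rewrite -mulr_suml a1 mul1r.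
apply: ler_sum => i _; rewrite -mulrBr normrM ger0_norm//.
by have [->|ai] := eqVneq (a i) 0; rewrite ?mul0r// ler_wpM2l// zM.
Qed.

End Hull.

Section ActiveHull.
Context {R : realType} {m J : nat}.
Context (P : 'I_J -> set 'rV[R]_m) (fs : 'I_J -> 'rV[R]_m -> R).
Implicit Types (x y : 'rV[R]_m).

Local Notation hull := (fun x => conv_hull (active_grads P fs x)).

(* The weights of coinciding gradients are merged, so that hull elements are
   indexed by the fixed finite type ['I_J]. *)
Lemma conv_hull_activeP x y : hull x y <->
  exists a : 'I_J -> R, [/\ forall j, 0 <= a j, \sum_j a j = 1,
    forall j, a j != 0 -> closure (P j) x & y = \sum_j a j *: grad (fs j) x].
Proof.
split => [[n [a [z [a0 a1 Az ->]]]]|[a [a0 a1 aP ->]]].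
  have /choice[s sP] i : exists j, closure (P j) x /\ grad (fs j) x = z i.
    by have [j ? <-] := Az i; exists j.
  exists (fun j => \sum_(i | s i == j) a i); split.
  - by move=> j; rewrite sumr_ge0.
  - by rewrite -a1 (partition_big s xpredT).
  - move=> j; apply: contraNP => nPj; rewrite big1// => i /eqP sij.
    by case: nPj; rewrite -sij; exact: (sP i).1.
  - rewrite (partition_big s xpredT)//=; apply: eq_bigr => j _.
    by rewrite scaler_suml; apply: eq_bigr => i /eqP <-; rewrite (sP i).2.
(* [conv_hull] wants a point of the set at every index, even one of weight zero. Such indices are
   redirected to an active [j0], which exists because the weights sum to 1. *)
have [j0 Pj0] : exists j, closure (P j) x.
  apply: contrapT => /forallNP nP; have : \sum_j a j = 0.
    by rewrite big1// => j _; apply/eqP; apply: contraT => /aP/(nP j).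
  by rewrite a1 => /eqP; rewrite oner_eq0.
pose s j := if a j == 0 then j0 else j.
exists J, a, (fun j => grad (fs (s j)) x); split => //.
- move=> j; exists (s j) => //=; rewrite /s.
  by case: eqVneq => // /aP.
- apply: eq_bigr => j _; rewrite /s.
  by case: eqVneq => // ->; rewrite !scale0r.
Qed.

Lemma conv_hull_active_nonempty x :
  (exists j, closure (P j) x) -> hull x !=set0.
Proof.
move=> [j Pj]; exists (grad (fs j) x), 1%N, (fun=> 1), (fun=> grad (fs j) x).
by split => //; [rewrite big_ord1|exists j|rewrite big_ord1 scale1r].
Qed.

Lemma conv_hull_active_convex x :
  convex_set (hull x : set (convex_lmodType _)).
Proof.
move=> y z l /set_mem/conv_hull_activeP[a [a0 a1 aP ->]].
move=> /set_mem/conv_hull_activeP[b [b0 b1 bP ->]].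
have l0 : 0 <= l%:num by [].
have l1 : 0 <= 1 - l%:num by rewrite subr_ge0.
apply/mem_set/conv_hull_activeP.
exists (fun j => l%:num * a j + (1 - l%:num) * b j); split.
- by move=> j; rewrite addr_ge0// mulr_ge0.
- by rewrite big_split/= -!mulr_sumr a1 b1 !mulr1 addrC subrK.
- move=> j H; have [aj|/aP//] := eqVneq (a j) 0.
  have [bj|/bP//] := eqVneq (b j) 0.
  by move: H; rewrite aj bj !mulr0 addr0 eqxx.
- rewrite [LHS](_ : _ = l%:num *: (\sum_j a j *: grad (fs j) x) +
    (1 - l%:num) *: (\sum_j b j *: grad (fs j) x))// !scaler_sumr -big_split/=.
  by apply: eq_bigr => j _; rewrite !scalerA -scalerDl.
Qed.

(** The hull is the continuous image of a face of the standard simplex of weights, and that face is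
    closed and bounded. *)
Lemma conv_hull_active_compact x : compact (hull x).
Proof.
pose S := [set a : 'rV[R]_J | [/\ forall j, 0 <= a 0 j, \sum_j a 0 j = 1 &
  forall j, a 0 j != 0 -> closure (P j) x]].
pose F (a : 'rV[R]_J) : 'rV[R]_m := \sum_j a 0 j *: grad (fs j) x.
have -> : hull x = F @` S.
  apply/seteqP; split => y.
    move=> /conv_hull_activeP[a [a0 a1 aP ->]]; exists (\row_j a j).
      split; [by move=> j; rewrite mxE| |by move=> j; rewrite mxE; exact: aP].
      by rewrite -a1; apply: eq_bigr => j _; rewrite mxE.
    by apply: eq_bigr => j _; rewrite mxE.
  move=> [a [a0 a1 aP] <-]; apply/conv_hull_activeP.
  by exists (fun j => a 0 j).
apply: continuous_compact.
  apply: continuous_subspaceT; apply: sum_continuous => j a.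
  by apply: (@cvgZr_tmp _ 'rV[R]_m _ (nbhs a) _ (fun b : 'rV[R]_J => b 0 j));
    exact: coord_continuous.
apply: bounded_closed_compact.
  exists 1; split => // M M1 a [a0 a1 _]; apply/ltW/(le_lt_trans _ M1).
  rewrite [leLHS]/Num.Def.normr/= mx_normrE bigmax_le//= => -[i j] _ /=.
  rewrite ord1 ger0_norm// -a1 (bigD1 j)//= lerDl sumr_ge0//.
have cc (j : 'I_J) : continuous (fun a : 'rV[R]_J => a 0 j : R).
  by move=> a; exact: coord_continuous.
(* The support condition becomes vanishing of the inactive weights, so that every condition is
   visibly closed. *)
have -> : S = (\bigcap_j [set a : 'rV[R]_J | 0 <= a 0 j]) `&`
    [set a : 'rV[R]_J | \sum_j a 0 j = 1] `&`
    \bigcap_(j in [set j | ~ closure (P j) x]) [set a : 'rV[R]_J | a 0 j = 0].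
  apply/seteqP; split => a.
    move=> [a0 a1 aP]; split; [split => //|] => [j _|j nPj]; first exact: a0.
    by apply/eqP; apply: contraT => /aP/nPj.
  move=> [[a0 a1] aP]; split => //; first by move=> j; exact: a0.
  by move=> j; apply: contraNP => /aP ->.
apply: closedI; [apply: closedI|]; [apply: closed_bigI => j _| |
  apply: closed_bigI => j _].
- have := @preimage_closed _ _ (fun a : 'rV[R]_J => a 0 j : R) [set y | 0 <= y].
  by apply; [move=> a _; exact: cc|exact: closed_ge].
- have := @preimage_closed _ _ (fun a : 'rV[R]_J => \sum_j a 0 j : R) [set 1].
  apply; last exact: closed_eq.
  move=> a _.
  by apply: (@sum_continuous _ _ R^o _ (fun j (a : 'rV[R]_J) => a 0 j)).
- have := @preimage_closed _ _ (fun a : 'rV[R]_J => a 0 j : R) [set 0].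
  by apply; [move=> a _; exact: cc|exact: closed_eq].
Qed.

End ActiveHull.

(** * Derivatives along curves *)

Lemma is_derive_comp_grad (R : realType) (m : nat) (F : 'rV[R]_m -> R)
    (v : R -> 'rV[R]_m) (t : R) :
  differentiable F (v t) -> derivable v t 1 ->
  is_derive t 1 (F \o v) (dotv ('D_1 v t) (grad F (v t))).
Proof.
move=> dF dv; have /derivable1_diffP dv' := dv.
have dFv : differentiable (F \o v) t by exact: differentiable_comp.
apply: DeriveDef; first exact: diff_derivable.
by rewrite deriveE// diff_comp//= diff_grad// dotvC (deriveE _ dv').
Qed.

(** Near [t] the difference quotients are close to a nonzero limit, hence nonzero, which leaves no
    other zero of [phi] there. *)
Lemma isolated_zero_of_derive (R : realType) (phi : R -> R) (t : R) :
  derivable phi t 1 -> phi t = 0 -> 'D_1 phi t != 0 ->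
  isolated [set s | phi s = 0] t.
Proof.
move=> dphi phi0 D0; split; first exact: mem_set.
have /= H : (fun h : R => h^-1 *: (phi (h *: 1 + t) - phi t)) @ 0^' --> 'D_1 phi t.
  exact: dphi.
have {H}[d /= d0 H] := cvgr_neq0 _ H D0.
exists [set s | s != t -> phi s != 0].
  apply/nbhs_ballP; exists d => //= s ts st.
  have : (s - t)^-1 *: (phi ((s - t) *: 1 + t) - phi t) != 0.
    by apply: H; [rewrite /= sub0r normrN distrC|rewrite subr_eq0].
  rewrite phi0 subr0 [_ *: 1]mulr1 subrK.
  by apply: contraNneq => ->; rewrite scaler0.
apply/seteqP; split => s /=.
  by move=> [st ps]; apply/eqP; apply: contraT => /st; rewrite ps eqxx.
by move=> ->; rewrite eqxx.
Qed.

(** [g] may switch between the [F j] arbitrarily often near [t]. Each of its difference quotients is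
    still one of some [F j], and finitely many of these converge to [c] uniformly in [j]. *)
Lemma is_derive_selection (R : realType) (J : nat) (A : set 'I_J)
    (F : 'I_J -> R -> R) (g : R -> R) (t c : R) :
  (forall j, A j -> is_derive t 1 (F j) c) ->
  (forall j, A j -> F j t = g t) ->
  (\forall s \near t, exists2 j, A j & g s = F j s) ->
  is_derive t 1 g c.
Proof.
move=> dF Fg gF.
suff H : (fun h : R => h^-1 *: (g (h *: 1 + t) - g t)) @ 0^' --> c.
  apply: DeriveDef; first by apply/cvg_ex; exists c.
  exact: cvg_lim.
apply/cvgrPdist_le => e e0.
have HF : \forall h \near 0^', forall j, A j ->
    `|c - h^-1 *: (F j (h *: 1 + t) - F j t)| <= e.
  apply: filter_forall => j.
  have [Aj|nAj] := pselect (A j); last by apply: nearW.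
  have [dFj DFj] := dF j Aj.
  have : (fun h : R => h^-1 *: (F j (h *: 1 + t) - F j t)) @ 0^' --> c.
    by rewrite -DFj; exact: dFj.
  by move=> /cvgrPdist_le/(_ _ e0); apply: filterS.
have Hg : \forall h \near 0^', exists2 j, A j & g (h *: 1 + t) = F j (h *: 1 + t).
  have /nbhs0P Hg := gF.
  apply: nbhs_dnbhs; apply: filterS Hg => h.
  by rewrite [_ *: 1]mulr1 addrC.
apply: filterS2 HF Hg => h HF [j Aj gj].
by rewrite gj -(Fg _ Aj); exact: HF.
Qed.

Lemma ae_not_isolated (R : realType) (S : set R) :
  {ae (@lebesgue_measure R), forall t, ~ isolated S t}.
Proof.
have c := countable_isolated S.
exists (isolated S); split.
- exact: countable_measurable.
- exact: countable_lebesgue_measure0.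
- by move=> t /= /contrapT.
Qed.

(** * Piecewise smooth functions *)

Section PiecewiseSelection.
Context {R : realType} {m J : nat}.
Context (P : 'I_J -> set 'rV[R]_m) (fs : 'I_J -> 'rV[R]_m -> R).
Context (f : 'rV[R]_m -> R).
Context (fs_diff : forall j x, differentiable (fs j) x).
Context (fs_grad : forall j, continuous (grad (fs j))).
Context (f_cont : continuous f).
Context (P_cover : forall x, exists j, P j x).
Context (f_agree : forall j x, P j x -> f x = fs j x).
Implicit Types x y : 'rV[R]_m.

Local Notation hull := (fun x => conv_hull (active_grads P fs x)).

(** The closures missing [x] are finitely many closed sets, so some neighbourhood of [x] avoids them
    all. *)
Lemma near_active x :
  \forall y \near x, forall j, closure (P j) y -> closure (P j) x.
Proof.
apply: (filter_forall (nbhs_filter x)) => j.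
have [Px|nPx] := pselect (closure (P j) x); first exact: nearW.
have : open (~` closure (P j)) by apply: closed_openC; exact: closed_closure.
by rewrite openE => /(_ _ nPx); apply: filterS.
Qed.

Lemma selection_agree_closure j x : closure (P j) x -> f x = fs j x.
Proof.
move=> Px; apply/eqP; rewrite -subr_eq0; apply/eqP.
have cl : closed [set y | f y - fs j y = 0].
  apply: (@preimage_closed _ _ (fun y => f y - fs j y : R) [set 0]).
    move=> y _; apply: (@cvgB _ R^o _ (nbhs y)); first exact: f_cont.
    exact: differentiable_continuous.
  exact: closed_eq.
apply: cl; apply: closure_subset Px => y Py /=.
by rewrite (f_agree Py) subrr.
Qed.

Lemma near_grads_bounded x :
  exists M : R, \forall y \near x, forall j, `|grad (fs j) y| <= M.
Proof.
(* The sum dominates each of its nonnegative terms, and the 1 is the slack for moving from [x] to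
   [y]. *)
exists (\sum_j (`|grad (fs j) x| + 1)).
apply: (filter_forall (nbhs_filter x)) => j.
have /cvgrPdist_le/(_ _ ltr01) := @fs_grad j x; apply: filterS => y xy.
rewrite (bigD1 j)//=; apply: ler_wpDr.
  by apply: sumr_ge0 => i _; rewrite addr_ge0.
by rewrite -lerBlDl (le_trans (lerB_dist _ _))// distrC.
Qed.

Lemma selection_locally_lipschitz : locally_lipschitz f.
Proof.
move=> x; have [M /nbhs_ballP[r /= r0 rM]] := near_grads_bounded x.
exists (ball x r); first exact: nbhsx_ballx.
exists (m%:R * M + 1); split; first exact: num_real.
move=> L /ltW ML [y z] [/= yr zr].
apply: (@le_trans _ _ ((m%:R * M + 1) * `|y - z|)); last by rewrite ler_wpM2r.
apply: (@lipschitz_ball_of_near _ 'rV[R]_m f x r) yr zr => u ur.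
have : \forall w \near u, forall j, `|fs j w - fs j u| <=
    (m%:R * M + 1) * `|w - u|.
  apply: (filter_forall (nbhs_filter u)) => j.
  by apply: near_slope_le => //; exact: rM.
apply: filterS2 (near_active u) => w uw wL.
(* A piece containing [w] is active at [u] as well, so the increment of [f] is an increment of that
   single [fs j]. *)
have [j Pj] := P_cover w.
have Pju : closure (P j) u by apply: uw; exact: subset_closure.
by rewrite (f_agree Pj) (selection_agree_closure Pju).
Qed.

Lemma selection_hull_locally_bounded : locally_bounded hull.
Proof.
move=> x; have [M xM] := near_grads_bounded x.
exists [set y | forall j, `|grad (fs j) y| <= M] => //.
exists M; split; first exact: num_real.
move=> L /ltW ML z [y /= yM /conv_hull_activeP[a [a0 a1 aP ->]]].
by rewrite (le_trans _ ML)//; exact: wavg_norm_le.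
Qed.

Lemma selection_hull_nonempty x : hull x !=set0.
Proof.
apply: conv_hull_active_nonempty.
by have [j Pj] := P_cover x; exists j; exact: subset_closure.
Qed.

(** This is upper semicontinuity of the hull: the weights are kept and each gradient at [y] is
    replaced by the one at [x], which is legitimate since pieces active at [y] are active at [x]. *)
Lemma selection_hull_near x (e : R) : 0 < e -> \forall y \near x,
  forall z, hull y z -> exists2 z', hull x z' & `|z - z'| <= e.
Proof.
move=> e0.
have : \forall y \near x, forall j, `|grad (fs j) x - grad (fs j) y| <= e.
  apply: (filter_forall (nbhs_filter x)) => j.
  by have /cvgrPdist_le := @fs_grad j x; apply.
apply: filterS2 (near_active x) => y xy He z.
move=> /conv_hull_activeP[a [a0 a1 aP ->]].
exists (\sum_j a j *: grad (fs j) x).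
  by apply/conv_hull_activeP; exists a; split => // j /aP; exact: xy.
rewrite -sumrB; under eq_bigr do rewrite -scalerBr.
by apply: wavg_norm_le => // j _; rewrite distrC.
Qed.

Lemma selection_hull_graph_closed : graph_closed hull.
Proof.
move=> [x y] xy /=.
have : closed (hull x).
  apply: compact_closed; first exact: norm_hausdorff.
  exact: conv_hull_active_compact.
apply => B /nbhs_ballP[e /= e0 eB].
have e2 : 0 < e / 2 by rewrite divr_gt0.
have [|[u w] [/= uw [xu yw]]] := xy ([set u | forall z, hull u z ->
    exists2 z', hull x z' & `|z - z'| <= e / 2 ] `*` ball y (e / 2)).
  exists ([set u | forall z, hull u z ->
      exists2 z', hull x z' & `|z - z'| <= e / 2 ], ball y (e / 2)) => //.
  by split; [exact: selection_hull_near|exact: nbhsx_ballx].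
have [z xz wz] := xu _ uw.
exists z; split => //; apply: eB.
move: yw; rewrite -!ball_normE /= => yw.
rewrite -(subrKA w) (le_lt_trans (ler_normD _ _))//.
by rewrite (splitr e) ltr_leD.
Qed.

(** As the weights sum to 1, the error for a convex combination is the weighted average of the
    errors of the active pieces, each of which represents [f] at both [x] and [y]. *)
Lemma selection_semismooth x (e : R) : 0 < e ->
  \forall y \near x, forall xi, hull y xi ->
    `|f y - f x - dotv xi (y - x)| <= e * `|y - x|.
Proof.
move=> e0.
have : \forall y \near x, forall j,
    `|fs j y - fs j x - dotv (grad (fs j) y) (y - x)| <= e * `|y - x|.
  apply: (filter_forall (nbhs_filter x)) => j.
  by apply: near_first_order_end => //; exact: fs_grad.
apply: filterS2 (near_active x) => y xy He xi.
move=> /conv_hull_activeP[a [a0 a1 aP ->]].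
rewrite dotv_suml; under eq_bigr do rewrite dotvZl.
apply: wavg_dist_le => // j /aP Py.
by rewrite (selection_agree_closure Py) (selection_agree_closure (xy _ Py)).
Qed.

Lemma selection_semismooth_gradient : semismooth_gradient f hull.
Proof.
split.
- exact: selection_locally_lipschitz.
- exact: selection_hull_locally_bounded.
- exact: selection_hull_graph_closed.
- exact: selection_hull_nonempty.
- exact: conv_hull_active_compact.
- exact: conv_hull_active_convex.
move=> x; apply/eqoP => e e0.
have /nbhs0P := selection_semismooth x e0.
apply: filterS => h He /=.
(* A witness makes the set nonempty: this is needed both to bound [sup] from above and to see that
   it is nonnegative. *)
have [xi0 Hxi0] := selection_hull_nonempty (x + h).
set S := (X in sup X).
have Sub : ubound S (e * `|h|).
  by move=> _ [xi Hxi <-]; have := He _ Hxi; rewrite [x + h]addrC addrK.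
have Sxi0 : S `|f (x + h) - f x - dotv xi0 h| by exists xi0.
rewrite ger0_norm.
  by apply: ge_sup => //; exists `|f (x + h) - f x - dotv xi0 h|.
by apply: le_trans (ub_le_sup _ Sxi0) => //; exists (e * `|h|).
Qed.

Lemma selection_chain_rule (v : R -> 'rV[R]_m) :
  [lipschitz v t | t in `[0, 1]%classic] -> chain_rule_along f hull v.
Proof.
move=> vL.
have vd : {ae (@lebesgue_measure R), forall t, forall i,
    0 < t < 1 -> derivable (fun s => v s 0 i) t 1}.
  apply: filter_forall => i; apply: lipschitz_ae_derivable.
  have [M M0 vM] := pinfty_ex_gt0 vL.
  exists M; split; first exact: num_real.
  move=> L /ltW ML [s t] st /=.
  apply: (@le_trans _ _ (M * `|s - t|)); last by rewrite ler_wpM2r.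
  apply: (le_trans _ (vM _ st)) => /=.
  by have := coord_norm_le (v s - v t) i; rewrite !mxE.
(* For each of the finitely many pairs, the isolated times of coincidence form a countable, hence
   null, set. *)
have zd : {ae (@lebesgue_measure R), forall t, forall ij : 'I_J * 'I_J,
    ~ isolated [set s | fs ij.1 (v s) - fs ij.2 (v s) = 0] t}.
  by apply: filter_forall => ij; exact: ae_not_isolated.
have nend : {ae (@lebesgue_measure R), forall t : R, ~ [set 0; 1] t}.
  exists [set 0; 1]; split; last by move=> t /= /contrapT.
    exact: measurableU.
  by apply/countable_lebesgue_measure0/finite_set_countable/finite_set2.
have aeF := ae_filter_ringOfSetsType (@lebesgue_measure R).
apply: filterS3 vd zd nend => t vd zd /not_orP[/eqP t0 /eqP t1] /=.
rewrite in_itv/= => /andP[t0' t1'].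
have t01 : 0 < t < 1 by rewrite !lt_neqAle t0' t1' t1 eq_sym t0.
have dv : derivable v t 1.
  by apply/derivable_mxP => i j; rewrite ord1; exact: vd.
have dfv j := is_derive_comp_grad (@fs_diff j (v t)) dv.
have [j0 Pj0] := P_cover (v t).
have {}Pj0 : closure (P j0) (v t) by exact: subset_closure.
set c := dotv ('D_1 v t) (grad (fs j0) (v t)).
(* Otherwise [fs j \o v - fs j0 \o v] would vanish at [t] with nonzero derivative, making [t] one of
   the isolated zeros excluded by [zd]. *)
have cE j : closure (P j) (v t) -> dotv ('D_1 v t) (grad (fs j) (v t)) = c.
  move=> Pj; apply/eqP; rewrite -subr_eq0; apply: contraT => ne.
  case: (zd (j, j0)).
  have [d1 D1] := dfv j; have [d2 D2] := dfv j0.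
  have := @isolated_zero_of_derive R ((fs j \o v) - (fs j0 \o v)) t.
  apply; first exact: derivableB.
    rewrite -[LHS]/(fs j (v t) - fs j0 (v t)).
    rewrite -(selection_agree_closure Pj) -(selection_agree_closure Pj0).
    by rewrite subrr.
  by rewrite deriveB// D1 D2.
have [dfv' Dfv] : is_derive t 1 (f \o v) c.
  apply: (@is_derive_selection R J [set j | closure (P j) (v t)]
      (fun j => fs j \o v)).
  - by move=> j Pj; rewrite -(cE _ Pj); exact: dfv.
  - by move=> j Pj /=; rewrite (selection_agree_closure Pj).
  have vc : {for t, continuous v}.
    by apply: differentiable_continuous; exact/derivable1_diffP.
  have H : \forall s \near t, forall j, closure (P j) (v s) -> closure (P j) (v t)
    := vc _ (near_active (v t)).
  apply: filterS H => s H; have [j Pj] := P_cover (v s).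
  by exists j; [apply: H; exact: subset_closure|exact: f_agree].
split => // u /conv_hull_activeP[a [a0 a1 aP ->]].
(* Every active gradient pairs with the velocity to [c], so a convex combination of them does
   too. *)
rewrite Dfv dotvC dotv_suml.
rewrite -[LHS]mul1r -[X in X * c]a1 mulr_suml; apply: eq_bigr => j _.
rewrite dotvZl; have [->|/aP Pj] := eqVneq (a j) 0; first by rewrite !mul0r.
by rewrite -(cE _ Pj) dotvC.
Qed.

Lemma selection_conservative_field : conservative_field f hull.
Proof.
split.
- exact: selection_locally_lipschitz.
- exact: selection_hull_locally_bounded.
- exact: selection_hull_graph_closed.
- exact: selection_hull_nonempty.
- exact: selection_chain_rule.
Qed.

End PiecewiseSelection.

Unset Implicit Arguments.

Theorem proposition3p5 (R : realType) (m : nat) (m_gt0 : (0 < m)%N)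
    (p : option nat) (p_neq0 : p <> Some 0%N)
    (f : 'rV[R]_m -> R) (f_pw : piecewise_Cp p f)
    (J : nat) (P : 'I_J -> set 'rV[R]_m) (fs : 'I_J -> 'rV[R]_m -> R)
    (f_repr : representation p f P fs) :
  conservative_field f (fun x => conv_hull (active_grads P fs x)) /\
  semismooth_gradient f (fun x => conv_hull (active_grads P fs x)).
Proof.
have [_ _ _ Pcov fsC agr] := f_repr; have [f_cont _] := f_pw.
have C1 j := is_Cp_C1 p_neq0 (fsC j).
have cov x : exists j, P j x.
  have : [set: 'rV[R]_m] x by [].
  by rewrite -Pcov => -[j _ Pj]; exists j.
split.
- by apply: selection_conservative_field => // j; case: (C1 j).
- by apply: selection_semismooth_gradient => // j; case: (C1 j).
Qed.
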